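(* Consider a boundary node $(-)$ on an electrically conducting solid wall with wall conductance coefficient $c_d\in(0,\infty]$ (with $c_d^{-1}=0$ for a perfectly conducting wall), unit outward normal $\vec n$, prescribed wall velocity $\vec v^{\,\mathrm w}$ ($\vec v^{\,\mathrm w}\cdot\vec n=0$), prescribed external magnetic field $\vec B^0$ and prescribed heat entropy flux $g(t)$. Let $(\rho,\vec v,T,\vec B,\psi)^T$ be the primitive state at the node ($\rho>0$, $T>0$) and $\theta_{(\rho)},\theta_{(\vec v)},\theta_{(T)},\theta_{(\vec B)},\theta_{(\psi)}$ the components of the gradient of primitive variables at the node. Define the manufactured ghost state and gradient $$\mathbf v^{\nu,\mathrm{cond}}_{(+)}=\begin{bmatrix}\rho\\ -\vec v+2\vec v^{\,\mathrm w}\\ T\\ \vec B\\ \psi\end{bmatrix},\qquad\boldsymbol\theta^{\mathrm{cond}}_{(+)}=\begin{bmatrix}-\theta_{(\rho)}\\ \theta_{(\vec v)}\\ -\theta_{(T)}+2\kappa^{-1}Tg(t)\vec n\\ \theta_{(\vec B)}^{\,T}+2c_d^{-1}(\vec B^0-\vec B)^T\vec n\\ -\theta_{(\psi)}\end{bmatrix}.$$ Let $P(t)$ denote the resulting contribution at the node to the time derivative of the discrete entropy of the penalty terms for the visco-resistive flux together with the penalty on the gradient of the entropy variables, disregarding the interface dissipation operator $\mathrm{DISS}^\nu$ (see context). Then these penalty terms are (i) entropy conservative if the wall is adiabatic: if $g(t)=0$, then $P(t)=0$; (ii) entropy stable in the presence of a heat entropy flux: if $g(t)\neq0$, where $g$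 is a given $L^2$ function, then only a bounded amount of discrete entropy is exchanged at the node: for every $t_1>0$, there is a finite constant depending only on $g$ and $t_1$ (not on the numerical solution) that bounds $\int_0^{t_1}|P(t)|\,dt$.
   Context: Vectors are row vectors in $\mathbb R^3$, so $(\vec B^0-\vec B)^T\vec n$ is the $3\times3$ matrix with entries $(B^0_i-B_i)n_j$. Perfect gas $p=\rho RT$; constants $\mu_{NS},\mu_R,\kappa,\mu_0>0$. Specific entropy $s=\frac R{\gamma-1}\ln(T/T^* )-R\ln(\rho/\rho^* )$ ($T^*,\rho^*$ reference constants); entropy variables $\mathbf w^T=\left(\frac{\gamma R}{\gamma-1}-s-\frac{\|\vec v\|^2}{2T},\frac{\vec v}T,-\frac1T,\frac{\vec B}{\mu_0T},\frac\psi{\mu_0T}\right)$. Gradients: the gradient of primitive variables $\boldsymbol\theta$ has components $\theta_{(\rho)},\theta_{(T)},\theta_{(\psi)}\in\mathbb R^{1\times3}$ and $\theta_{(\vec v)},\theta_{(\vec B)}\in\mathbb R^{3\times3}$, with $(\theta_{(\vec v)})_{ij}$ playing the role of $\partial_{x_j}v_i$, and so on. At the interior node, $\boldsymbol\theta_{(-)}=[\partial\mathbf v/\partial\mathbf w]_{(-)}\mathbf g_{(-)}$, where $\mathbf g_{(-)}$ is the discrete gradient of the entropy variables; at the ghost node, $\mathbf g_{(+)}=[\partial\mathbf w/\partial\mathbf v]_{(+)}\boldsymbol\theta_{(+)}$, with the Jacobian evaluated at the ghost state. Diffusive (visco-resistive) flux: for a state $\mathbf v$ and primitive gradient $\boldsymbol\theta$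 the normal diffusive flux $\mathbf f^\nu$ is the component along $\vec n$ of the flux with rows (density, momentum, energy, magnetic field, $\psi$) $$\vec0;\quad\underline\tau;\quad\vec v\,\underline\tau-\vec q-\tfrac{\mu_R}{\mu_0^2}(\vec\nabla\times\vec B)\times\vec B;\quad\tfrac{\mu_R}{\mu_0}\left(\vec\nabla\vec B-(\vec\nabla\vec B)^T\right);\quad\vec0,$$ with $\underline\tau=\mu_{NS}(\vec\nabla\vec v+(\vec\nabla\vec v)^T)-\frac23\mu_{NS}(\vec\nabla\cdot\vec v)\underline I$, $\vec q=-\kappa\vec\nabla T$, where all derivatives are replaced by the corresponding entries of $\boldsymbol\theta$. (Equivalently, the flux in direction $i$ is $\sum_jC^\nu_{ij}(\mathbf u)\mathbf g_j$, with $\mathbf g_j$ the $j$-th component of the entropy-variable gradient.) Write $\mathbf f^\nu_{(-)}$, $\mathbf f^\nu_{(+)}$ for the normal diffusive fluxes of the interior and ghost states and gradients, and $\mathbf w_{(\pm)}$ for their entropy variables. Entropy contribution: with the BR1 averages $\hat{\mathbf w}=\frac12(\mathbf w_{(-)}+\mathbf w_{(+)})$ and $\hat{\mathbf f}^\nu=\frac12(\mathbf f^\nu_{(-)}+\mathbf f^\nu_{(+)})$, the penalty terms (on the diffusive flux and on the gradient of the entropy variables), without $\mathrm{DISS}^\nu$, contribute to the time derivative of the discrete entropy at the boundary node $$P=(\hat{\mathbf w}-\mathbf w_{(-)})^T\mathbf f^\nu_{(-)}+\mathbf w_{(-)}^T\hat{\mathbf f}^\nu=\tfrac12\left(\mathbf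 w_{(+)}^T\mathbf f^\nu_{(-)}+\mathbf w_{(-)}^T\mathbf f^\nu_{(+)}\right).$$ ''Entropy conservative'' means $P=0$; ''entropy stable'' means that the entropy contributed at the node is bounded by the prescribed data. *)

(* Defs.v *)
From HB Require Import structures.
From mathcomp Require Import all_boot all_order all_algebra.
From mathcomp Require Import all_classical all_reals all_analysis.
Set Implicit Arguments.
Unset Strict Implicit.
Unset Printing Implicit Defensive.
Import Order.TTheory GRing.Theory Num.Theory.
Import numFieldNormedType.Exports.
Local Open Scope classical_set_scope.
Local Open Scope ring_scope.

Section VectorCalculus.
Variable R : realType.

Definition dotv (u v : 'rV[R]_3) : R := (u *m v^T) 0 0.

(* Indices live in 'I_3 = Z/3Z, so k + 1 and k + 2 are taken cyclically. *)
Definition crossmul (u v : 'rV[R]_3) : 'rV[R]_3 :=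
  \row_(k < 3) (u 0 (k + 1) * v 0 (k + 2%:R) - u 0 (k + 2%:R) * v 0 (k + 1)).

(* Gradients of vector fields follow the convention G i j = d_{x_j} v_i. *)
Definition curl (G : 'M[R]_3) : 'rV[R]_3 :=
  \row_(k < 3) (G (k + 2%:R) (k + 1) - G (k + 1) (k + 2%:R)).

Definition divergence (G : 'M[R]_3) : R := \tr G.

End VectorCalculus.

Record params (R : realType) := Params {
  Rgas : R; gamma : R;
  Tref : R; rhoref : R; (* T^* and rho^* in the specific entropy *)
  muNS : R; muR : R; kappa : R; mu0 : R }.

Definition admissible_params (R : realType) (c : params R) : Prop :=
  [/\ 0 < Rgas c, 1 < gamma c, 0 < Tref c & 0 < rhoref c] /\
  [/\ 0 < muNS c, 0 < muR c, 0 < kappa c & 0 < mu0 c].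

Record prim (R : realType) := Prim {
  rho : R; vel : 'rV[R]_3; temp : R; mag : 'rV[R]_3; psi : R }.

Definition physical (R : realType) (U : prim R) : Prop :=
  0 < rho U /\ 0 < temp U.

Record prim_grad (R : realType) := PrimGrad {
  grad_rho : 'rV[R]_3; grad_vel : 'M[R]_3; grad_temp : 'rV[R]_3;
  grad_mag : 'M[R]_3; grad_psi : 'rV[R]_3 }.

(* A nine-component state is a column vector split as
   density (1), momentum (3), energy (1), magnetic field (3), psi (1). *)
Notation nvar := (1 + (3 + (1 + (3 + 1))))%N.

Section ViscoResistive.
Variables (R : realType) (c : params R).

Definition specific_entropy (U : prim R) : R :=
  Rgas c / (gamma c - 1) * ln (temp U / Tref c)
  - Rgas c * ln (rho U / rhoref c).

Definition entropy_var (U : prim R) : 'cV[R]_nvar :=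
  (row_mx (gamma c * Rgas c / (gamma c - 1) - specific_entropy U
             - dotv (vel U) (vel U) / (2 * temp U))%:M
  (row_mx ((temp U)^-1 *: vel U)
  (row_mx (- (temp U)^-1)%:M
  (row_mx ((mu0 c * temp U)^-1 *: mag U)
          (psi U / (mu0 c * temp U))%:M))))^T.

Definition stress (th : prim_grad R) : 'M[R]_3 :=
  muNS c *: (grad_vel th + (grad_vel th)^T)
  - (2 / 3 * muNS c * divergence (grad_vel th))%:M.

Definition heat_flux (th : prim_grad R) : 'rV[R]_3 := - kappa c *: grad_temp th.

(* Column j is the diffusive flux in the direction x_j. *)
Definition diffusive_flux (U : prim R) (th : prim_grad R) : 'M[R]_(nvar, 3) :=
  col_mx (0 : 'rV[R]_3)
  (col_mx (stress th)
  (col_mx (vel U *m stress th - heat_flux th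
             - (muR c / mu0 c ^+ 2) *: crossmul (curl (grad_mag th)) (mag U))
  (col_mx ((muR c / mu0 c) *: (grad_mag th - (grad_mag th)^T))
          (0 : 'rV[R]_3)))).

Definition normal_diffusive_flux (n : 'rV[R]_3) (U : prim R)
    (th : prim_grad R) : 'cV[R]_nvar :=
  diffusive_flux U th *m n^T.

(* Entropy rate of the penalties on the diffusive flux and on the gradient of
   the entropy variables, with BR1 averages and no interface dissipation;
   m stands for the interior node (-) and p for the ghost node (+). *)
Definition penalty_rate (n : 'rV[R]_3) (Um : prim R) (thm : prim_grad R)
    (Up : prim R) (thp : prim_grad R) : R :=
  let wm := entropy_var Um in
  let wp := entropy_var Up in
  let fm := normal_diffusive_flux n Um thm in
  let fp := normal_diffusive_flux n Up thp in
  let what := 2^-1 *: (wm + wp) in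
  let fhat := 2^-1 *: (fm + fp) in
  ((what - wm)^T *m fm + wm^T *m fhat) 0 0.

End ViscoResistive.

(* The data prescribed on the wall besides the heat entropy flux; functions of R
   are functions of time. *)
Record wall (R : realType) := Wall {
  normal : 'rV[R]_3;
  conductance : \bar R;
  wall_vel : R -> 'rV[R]_3;
  ext_mag : R -> 'rV[R]_3 }.

Definition conducting_wall (R : realType) (W : wall R) : Prop :=
  [/\ dotv (normal W) (normal W) = 1,
      (0 < conductance W)%E &
      forall t, 0 <= t -> dotv (wall_vel W t) (normal W) = 0].

Section ConductingWall.
Variables (R : realType) (c : params R) (W : wall R) (g : R -> R).

Definition ghost_state (t : R) (U : prim R) : prim R :=
  Prim (rho U) (- vel U + 2 *: wall_vel W t) (temp U) (mag U) (psi U).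

(* In \bar R the inverse of +oo is 0, the perfectly conducting case. *)
Definition ghost_grad (t : R) (U : prim R) (th : prim_grad R) : prim_grad R :=
  PrimGrad (- grad_rho th)
    (grad_vel th)
    (- grad_temp th + (2 * (kappa c)^-1 * temp U * g t) *: normal W)
    ((grad_mag th)^T + (2 * fine ((conductance W)^-1)%E)
                         *: ((ext_mag W t - mag U)^T *m normal W))
    (- grad_psi th).

Definition wall_penalty_rate (U : R -> prim R) (th : R -> prim_grad R)
    (t : R) : R :=
  penalty_rate c (normal W) (U t) (th t)
    (ghost_state t (U t)) (ghost_grad t (U t) (th t)).

End ConductingWall.

(* g restricted to D and extended by 0 is measurable with finite L^2 norm. *)
Definition square_integrable_on (R : realType) (D : set R) (g : R -> R) : Prop :=
  g \_ D \in Lfun (@lebesgue_measure R) 2%:E.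

(* Main.v *)
(* The visco-resistive penalties collapse to P(t) = - g(t).  In the pairing of the
   entropy variables of one state with the flux of another, the magnetic part
   involves the magnetic field only through the difference of the two fields,
   because (curl B) x B = - B (grad B - (grad B)^T); the ghost state copies B
   and T, so this part vanishes whatever magnetic gradient is prescribed.  The
   viscous part is linear in the velocity jump, hence changes sign between the
   two pairings, and the temperature gradients cancel up to the prescribed heat
   entropy flux.  Thus g = 0 gives P = 0, and the integral of |P| is that of |g|,
   finite because L^2 is included in L^1 on a bounded interval. *)
Require Import Defs.
From HB Require Import structures.
From mathcomp Require Import all_boot all_order all_algebra.
From mathcomp Require Import all_classical all_reals all_analysis.
From mathcomp Require Import ring lra measurable_realfun.
Set Implicit Arguments.
Unset Strict Implicit.
Unset Printing Implicit Defensive.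
Import Order.TTheory GRing.Theory Num.Theory.
Import numFieldNormedType.Exports.
Local Open Scope classical_set_scope.
Local Open Scope ring_scope.

(** [G - G^T] is antisymmetric with axial vector [curl G], so it acts on rows as a cross product. *)
Lemma crossmul_curl (R : realType) (G : 'M[R]_3) (u : 'rV[R]_3) :
  crossmul (curl G) u = - (u *m (G - G^T)).
Proof.
apply/rowP => k; rewrite !mxE !big_ord_recl big_ord0 !mxE.
(* Expanded sums are indexed by lifts of [ord0], cross products by residues mod 3; these identities
   reconcile them. *)
have e0 : (ord0 : 'I_3) = 0 by [].
have e1 : lift ord0 ord0 = 1 :> 'I_3 by apply/val_inj.
have e2 : lift ord0 (lift ord0 ord0) = 2%:R :> 'I_3 by apply/val_inj.
have a3 : 1 + 2%:R = 0 :> 'I_3 by apply/val_inj.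
have a4 : 2%:R + 2%:R = 1 :> 'I_3 by apply/val_inj.
have a2 : 1 + 1 = 2%:R :> 'I_3 by apply/val_inj.
have a3' : 2%:R + 1 = 0 :> 'I_3 by apply/val_inj.
rewrite e2 e1 e0.
have [-> | [-> | ->]] : k = 0 \/ k = 1 \/ k = 2%:R.
  by case: k => -[|[|[|//]]] ?; [left|right;left|right;right]; apply/val_inj.
all: rewrite ?add0r ?(a2, a3, a4, a3', add0r); ring.
Qed.

(** The energy row, weighted by [-1/T], subtracts the terms in [vel V] and [mag V] from those of the
    momentum and magnetic rows. *)
Lemma entropy_flux_pairing (R : realType) (c : params R) (n : 'rV[R]_3)
    (U V : prim R) (th : prim_grad R) :
  (entropy_var c U)^T *m normal_diffusive_flux c n V th =
  (temp U)^-1 *: (((vel U - vel V) *m stress c th - kappa c *: grad_temp th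
    + (muR c / mu0 c ^+ 2) *:
        ((mag U - mag V) *m (grad_mag th - (grad_mag th)^T))) *m n^T).
Proof.
rewrite /normal_diffusive_flux /diffusive_flux /entropy_var trmxK !mul_col_mx.
rewrite !mul_row_col !mul0mx !mulmx0 add0r addr0 !mul_scalar_mx.
rewrite crossmul_curl /heat_flux.
move: (stress c th) (grad_mag th - _) => S J.
rewrite !(mulmxDl, mulNmx) -!scalemxAl !(mulmxDl, mulNmx) -!scalemxAr !mulmxA.
move: (vel U *m _ *m _) (vel V *m _ *m _) => a b.
move: (mag U *m _ *m _) (mag V *m _ *m _) (grad_temp th *m _) => d e q.
by apply/matrixP=> i j; rewrite !mxE !invfM; ring.
Qed.

Lemma wall_penalty_rateE (R : realType) (c : params R) (W : wall R)
    (g : R -> R) (U : R -> prim R) (th : R -> prim_grad R) (t : R) :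
  kappa c != 0 -> temp (U t) != 0 -> dotv (normal W) (normal W) = 1 ->
  wall_penalty_rate c W g U th t = - g t.
Proof.
move=> k0 T0 nn; rewrite /wall_penalty_rate /penalty_rate.
set wm := entropy_var c (U t); set wp := entropy_var c _.
set fm := normal_diffusive_flux _ _ _ _.
set fp := normal_diffusive_flux _ _ _ _.
(* Averaging turns the penalties into the cross pairings (wp, fm), (wm, fp). *)
have -> : (2^-1 *: (wm + wp) - wm)^T *m fm + wm^T *m (2^-1 *: (fm + fp)) =
    2^-1 *: (wp^T *m fm + wm^T *m fp).
  rewrite [(_ - _)^T]raddfB /= linearZ /= raddfD /=.
  rewrite !(mulmxDl, mulNmx) -!scalemxAl.
  rewrite !mulmxDl -scalemxAr mulmxDr.
  move: (_ *m _) (wp^T *m _) (wm^T *m fp) => a b d.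
  by apply/matrixP => i j; rewrite !mxE; field.
rewrite !entropy_flux_pairing /= !subrr !mul0mx !scaler0 !addr0.
(* The two velocity jumps become [d] and [- d], against the same stress since the ghost copies
   [grad_vel]. *)
rewrite /stress /= -[vel (U t) - _]opprB.
move: (- vel _ + _ - _) (muNS c *: _ - _) => d S.
rewrite [kappa c *: (_ + _)]scalerDr scalerN.
rewrite !(mulmxDl, mulNmx) -!scalemxAl.
move: nn; rewrite /dotv.
move: (_ *m _ *m _) (grad_temp _ *m _) (normal W *m _) => a q N nn.
by rewrite !mxE nn; field; rewrite k0 T0.
Qed.

Lemma square_integrable_on_integrable (R : realType) (a b : R) (g : R -> R) :
  square_integrable_on `[a, b] g ->
  (@lebesgue_measure R).-integrable `[a, b] (EFin \o g).
Proof.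
move=> L2; have mD : measurable (`[a, b]%classic : set R) by [].
have mg : measurable_fun `[a, b] g.
  apply/(measurable_restrictT _ mD); move: L2; rewrite /square_integrable_on inE.
  by case/andP; rewrite inE.
(* |g| <= 1 + g^2 *)
have i2 : (@lebesgue_measure R).-integrable `[a, b]
    (EFin \o (fun t => (g \_ `[a, b]) t ^+ 2)).
  by apply: integrableS (Lfun2_integrable_sqr L2).
have i1 : (@lebesgue_measure R).-integrable `[a, b] (EFin \o cst 1).
  apply/integrableP; split; first exact/measurable_EFinP.
  under eq_integral do rewrite /= normr1.
  rewrite integral_cst//= mul1e lebesgue_measure_itv/=.
  by case: ifP; rewrite ltry.
apply: le_integrable (integrableD _ i1 i2) => //; first exact/measurable_EFinP.
move=> t Dt; rewrite /= patchE mem_set// lee_fin.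
rewrite [leRHS]ger0_norm ?addr_ge0 ?sqr_ge0//.
(* Expanding the square gives [x <= x^2 + 1/4]. *)
have := sqr_ge0 (`|g t| - 2^-1); rewrite -[g t ^+ 2]real_normK ?num_real//.
move: `|g t| => x; nra.
Qed.

Theorem theorem6 (R : realType) :
  (forall (c : params R) (W : wall R) (g : R -> R)
          (U : R -> prim R) (th : R -> prim_grad R),
     admissible_params c -> conducting_wall W ->
     (forall t, 0 <= t -> physical (U t)) ->
     forall t, 0 <= t -> g t = 0 -> wall_penalty_rate c W g U th t = 0)
  /\
  (forall g : R -> R, (exists2 t, 0 <= t & g t <> 0) ->
   forall t1 : R, 0 < t1 -> square_integrable_on `[0, t1] g ->
   exists C : R,
   forall (c : params R) (W : wall R)
          (U : R -> prim R) (th : R -> prim_grad R),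
     admissible_params c -> conducting_wall W ->
     (forall t, 0 <= t -> physical (U t)) ->
     (\int[@lebesgue_measure R]_(t in `[0%R, t1])
        `|wall_penalty_rate c W g U th t|%:E <= C%:E)%E).
Proof.
split=> [c W g U th [_ [_ _ k0 _]] [nn _ _] phys t t0 gt0|g _ t1 _ L2].
  by rewrite wall_penalty_rateE ?gt0 ?oppr0 ?gt_eqF ?(phys t t0).2.
have /integrableP[_ fin] := square_integrable_on_integrable L2.
(* This constant is fixed before the wall and the solution, and the bound is attained with
   equality. *)
exists (fine (\int[@lebesgue_measure R]_(t in `[0%R, t1]) `|g t|%:E)%E).
move=> c W U th [_ [_ _ k0 _]] [nn _ _] phys.
rewrite fineK; last by rewrite ge0_fin_numE// integral_ge0.
rewrite le_eqVlt; apply/orP; left; apply/eqP/eq_integral => t.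
rewrite inE/= in_itv/= => /andP[t0 _].
by rewrite wall_penalty_rateE ?normrN ?gt_eqF ?(phys t t0).2.
Qed.
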